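(* Let $G$ be a finite group, $N$ a normal subgroup of $G$ contained in the center of $G$, and $T=\{t(\sigma):\sigma\in G/N\}$ a set of coset representatives with $t(1)=1$. Let $k\ge 2$ and let $t_1,\dots,t_k$ be chosen independently and uniformly from $T$. Let $r_1,\dots,r_k\in T$ be the successive remainders and $f_1,\dots,f_{k-1}\in N$ the carries produced when multiplying $t_1,t_2,\dots,t_k$. Then: 1. the remainder process $r_i$, $1\le i\le k$, is uniform and independent (i.e. the $r_i$ are independent and each is uniform on $T$); and 2. the carries $f_i$, $1\le i\le k-1$, form a stationary, one-dependent, two-block factor.
   Context: Each $g\in G$ is uniquely $g=n\,t(\sigma)$ with $n\in N$, $\sigma\in G/N$; there are uniquely determined elements $f(\sigma,\tau)\in N$ (the factor set) with $t(\sigma)t(\tau)=t(\sigma\tau)f(\sigma,\tau)$. Remainders and carries: $r_1=t_1$, and for $1\le i\le k-1$, $r_{i+1}\in T$ and $f_i\in N$ are the unique elements with $r_i t_{i+1}=r_{i+1}f_i$. A process $(f_i)_{1\le i\le k-1}$ is stationary if the joint law of $(f_j)_{j\in J}$ equals that of $(f_{j+m})_{j\in J}$ whenever $J,J+m\subseteq\{1,\dots,k-1\}$; one-dependent if $(f_j)_{j<i}$ and $(f_j)_{j>i}$ are independent for every $i$; a two-block factor if it has the form $f_i=h(Y_i,Y_{i+1})$ for a fixed function $h$ and independent identically distributed $Y_1,\dots,Y_k$. *)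

(* Defs.v *)
From HB Require Import structures.
From mathcomp Require Import all_boot ssralg ssrnum all_fingroup.
From mathcomp Require Import all_solvable.
From mathcomp Require Import boolp classical_sets functions reals ereal measure.

Set Implicit Arguments.
Unset Strict Implicit.
Unset Printing Implicit Defensive.

Local Open Scope classical_set_scope.
Local Open Scope ereal_scope.

(* A finite group with the sigma-algebra of all its subsets. *)
Definition discr (gT : finGroupType) : Type := gT.

Section DiscrMeasurable.
Variable gT : finGroupType.

HB.instance Definition _ := Choice.copy (discr gT) gT.
HB.instance Definition _ := isPointed.Build (discr gT) (1%g : gT).
HB.instance Definition _ := @isMeasurable.Build default_measure_display
  (discr gT) discrete_measurable (@discrete_measurable0 _)
  (@discrete_measurableC _) (@discrete_measurableU _).

End DiscrMeasurable.

(* Processes are functions of i : nat of which only X_1, ..., X_n matter; the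
   remaining values are never constrained. *)
Section Processes.
Context d (Omega : measurableType d) (R : realType) (P : probability Omega R).
Context d' (E : measurableType d').
Implicit Types (X : nat -> Omega -> E) (n : nat).

Definition measurable_process n X : Prop :=
  forall i, (1 <= i <= n)%N -> measurable_fun [set: Omega] (X i).

Definition mutually_independent n X : Prop :=
  measurable_process n X /\
  forall J : seq nat, uniq J -> (forall j, j \in J -> (1 <= j <= n)%N) ->
  forall B : nat -> set E, (forall j, measurable (B j)) ->
    P (\bigcap_(j in [set` J]) X j @^-1` B j) =
    \prod_(j <- J) P (X j @^-1` B j).

Definition identically_distributed n X : Prop :=
  measurable_process n X /\
  forall i j, (1 <= i <= n)%N -> (1 <= j <= n)%N ->
  forall B : set E, measurable B -> P (X i @^-1` B) = P (X j @^-1` B).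

Definition joint X m (J : m.-tuple nat) : Omega -> m.-tuple E :=
  fun w => [tuple X (tnth J i) w | i < m].

(* A finite set J of indices is represented by its increasing enumeration.
   Shifts by a negative m are covered by exchanging J and J + m. *)
Definition stationary n X : Prop :=
  measurable_process n X /\
  forall l (J : l.-tuple nat) (m : nat), sorted ltn J ->
  (forall j, j \in J -> (1 <= j <= n)%N /\ (1 <= j + m <= n)%N) ->
  forall B : set (l.-tuple E), measurable B ->
    P (joint X J @^-1` B) = P (joint X [tuple of map (addn^~ m) J] @^-1` B).

End Processes.

Definition independent_pair d (Omega : measurableType d) (R : realType)
    (P : probability Omega R) d1 (E1 : measurableType d1) d2
    (E2 : measurableType d2) (X : Omega -> E1) (Y : Omega -> E2) : Prop :=
  forall A B, measurable A -> measurable B ->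
    P (X @^-1` A `&` Y @^-1` B) = P (X @^-1` A) * P (Y @^-1` B).

Definition one_dependent d (Omega : measurableType d) (R : realType)
    (P : probability Omega R) d' (E : measurableType d') (n : nat)
    (X : nat -> Omega -> E) : Prop :=
  measurable_process n X /\
  forall i, (1 <= i <= n)%N ->
    independent_pair P (joint X [tuple of iota 1 (i - 1)])
                       (joint X [tuple of iota i.+1 (n - i)]).

Definition two_block_factor d (Omega : measurableType d) (R : realType)
    (P : probability Omega R) d' (E : measurableType d') (n : nat)
    (X : nat -> Omega -> E) : Prop :=
  exists (dF : measure_display) (F : measurableType dF)
         (Y : nat -> Omega -> F) (h : F * F -> E),
    [/\ mutually_independent P n.+1 Y,
        identically_distributed P n.+1 Y,
        measurable_fun [set: F * F] h &
        forall i, (1 <= i <= n)%N -> forall w, X i w = h (Y i w, Y i.+1 w)].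

Definition uniform_on d (Omega : measurableType d) (R : realType)
    (P : probability Omega R) (gT : finGroupType) (T : {set gT})
    (X : Omega -> discr gT) : Prop :=
  (forall w, (X w : gT) \in T) /\
  forall x : gT, x \in T -> P (X @^-1` [set x]) = ((#|T|%:R)^-1)%:E.

Section Carries.
Variable gT : finGroupType.
Local Open Scope group_scope.

(* For sigma in G / N, [rep sigma] belongs to the coset sigma; the values of
   rep outside G / N are irrelevant. *)
Definition coset_representatives (G N : {group gT}) (rep : coset_of N -> gT) :
    Prop :=
  forall sigma, sigma \in G / N -> rep sigma \in (sigma : {set gT}).

Definition remainders_carries (T N : {set gT}) (k : nat)
    (t r f : nat -> gT) : Prop :=
  r 1%N = t 1%N /\
  forall i, (1 <= i <= k.-1)%N ->
    [/\ r i.+1 \in T, f i \in N & r i * t i.+1 = r i.+1 * f i].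

(* The decomposition used at each step of [remainders_carries] exists and is
   unique. *)
Lemma remainder_carry_unique (G N : {group gT}) (rep : coset_of N -> gT)
    (x : gT) :
  N <| G -> coset_representatives G rep -> x \in G ->
  exists! p : gT * gT,
    [/\ p.1 \in rep @: (G / N), p.2 \in N & x = p.1 * p.2].
Proof.
move=> nNG repP xG.
have Nn y : y \in G -> y \in 'N(N).
  exact: (fintype.subsetP (normal_norm nNG)).
have cosetrep s : s \in G / N -> rep s \in 'N(N) /\ coset N (rep s) = s.
  move=> sGN; have rs := repP _ sGN.
  by split; [exact: (fintype.subsetP (coset_norm s)) | exact: coset_mem].
have sGN : coset N x \in G / N by rewrite mem_quotient.
have [Nrx crx] := cosetrep _ sGN.
exists (rep (coset N x), (rep (coset N x))^-1 * x); split=> /=.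
  split; [exact: imset_f | | by rewrite mulKVg].
  have NrV : (rep (coset N x))^-1 \in 'N(N) by rewrite groupV.
  apply: coset_idr; first exact: groupM NrV (Nn x xG).
  by rewrite morphM ?(Nn x xG) // morphV //= crx mulVg.
case=> y n /= [/imsetP[s sG ->] nN ->].
have [Nrs crs] := cosetrep _ sG.
have -> : coset N (rep s * n) = s by rewrite coset_kerr.
by rewrite mulKg.
Qed.

End Carries.

(* Main.v *)
Require Import Defs.
From mathcomp Require Import all_boot ssralg ssrnum all_fingroup.
From mathcomp Require Import all_solvable.
From mathcomp Require Import boolp classical_sets functions reals ereal measure.
From mathcomp Require Import cardinality fsbigop.

(* Modulo N the carries disappear: the coset of r_(i+1) is the product of the
   cosets of r_i and t_(i+1).  Hence (t_1, ..., t_k) and (r_1, ..., r_k)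
   determine each other, the second giving back the first through
   t_(i+1) = rep (r_i^-1 r_(i+1) N), so (r_1, ..., r_k) is uniform on T^k.
   Then f_i = r_(i+1)^-1 r_i t_(i+1) is a fixed function of (r_i, r_(i+1)), a
   two-block factor of an i.i.d. process, and every such factor is stationary
   and one-dependent. *)

Set Implicit Arguments.
Unset Strict Implicit.
Unset Printing Implicit Defensive.

Import GRing.Theory Num.Theory.
Local Open Scope classical_set_scope.
Local Open Scope ereal_scope.

(** * Maps with finitely many values *)

Section FiniteValued.
Context d (Omega : measurableType d).

Lemma preimage_bigcup1 (F : Type) (Z : Omega -> F) (A : set F) :
  Z @^-1` A = \bigcup_(x in A) Z @^-1` [set x].
Proof. by rewrite -preimage_bigcup bigcup_imset1 image_id. Qed.

(** Every preimage is a finite union of fibres. [F] carries no sigma-algebra here, so the lemma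
    applies to pairs, tuples and finite functions alike. *)
Lemma measurable_preimage_fin (F : finType) (Z : Omega -> F) (A : set F) :
  (forall x, measurable (Z @^-1` [set x])) -> measurable (Z @^-1` A).
Proof.
move=> mZ; rewrite preimage_bigcup1; exact: fin_bigcup_measurable.
Qed.

Lemma measure_preimage_fin (R : realType) (P : probability Omega R)
    (F : finType) (Z : Omega -> F) (A : set F) :
  (forall x, measurable (Z @^-1` [set x])) ->
  P (Z @^-1` A) = \sum_(x : F | x \in A) P (Z @^-1` [set x]).
Proof.
move=> mZ; rewrite preimage_bigcup1 measure_fin_bigcup //.
- rewrite (fsbigE [seq x <- index_enum F | x \in A]).
  + by rewrite big_filter_cond; apply: eq_bigl => x; rewrite andbb.
  + by rewrite filter_uniq ?index_enum_uniq.
  + by move=> x /=; rewrite mem_filter => /andP[/set_mem].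
  + by move=> x /mem_set xA; rewrite mem_filter xA mem_index_enum.
- exact: finite_finset.
- exact: trivIset_preimage1.
Qed.

Lemma measurable_preimage_discr (gT : finGroupType) (X : Omega -> discr gT) B :
  measurable_fun setT X -> measurable (X @^-1` B).
Proof. by move=> mX; rewrite -[_ @^-1` _]setTI; exact: mX. Qed.

(** The fibres of the pair [(X, Y)] are intersections of fibres of [X] and [Y], and there are
    finitely many of them; hence [h] can be arbitrary. *)
Lemma measurable_discr2 (gT hT kT : finGroupType) (X : Omega -> discr gT)
    (Y : Omega -> discr hT) (h : gT -> hT -> discr kT) :
  measurable_fun setT X -> measurable_fun setT Y ->
  measurable_fun setT (fun w => h (X w) (Y w)).
Proof.
move=> mX mY _ B _; rewrite setTI.
have -> : (fun w => h (X w) (Y w)) @^-1` B =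
    (fun w => (X w : gT, Y w : hT)) @^-1` [set p | B (h p.1 p.2)] by [].
apply: measurable_preimage_fin => -[x y].
have -> : (fun w => (X w : gT, Y w : hT)) @^-1` [set (x, y)] =
    X @^-1` [set x] `&` Y @^-1` [set y].
  by apply/seteqP; split=> w /= [-> ->].
by apply: measurableI; exact: measurable_preimage_discr.
Qed.

End FiniteValued.

(** * Independence and joint laws of families with values in a finite group *)

Section Independence.
Context d (Omega : measurableType d) (R : realType) (P : probability Omega R).
Variable gT : finGroupType.
Implicit Types (X Y : nat -> Omega -> discr gT) (n : nat).

Lemma measurable_bigcap_seq X n (J : seq nat) (B : nat -> set (discr gT)) :
  measurable_process n X -> (forall j, j \in J -> (1 <= j <= n)%N) ->
  measurable (\bigcap_(j in [set` J]) X j @^-1` B j).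
Proof.
move=> mX Jn; apply: fin_bigcap_measurable; first exact: finite_seq.
by move=> j /= /Jn jn; apply: measurable_preimage_discr; exact: mX.
Qed.

(** When the indices are distinct, [index j J] is the coordinate of [j]. A joint point event thus
    takes the form in which mutual independence is stated. *)
Lemma joint_preimage1 X l (J : l.-tuple nat) (s : l.-tuple gT) : uniq J ->
  joint X J @^-1` [set s] =
  \bigcap_(j in [set` J]) X j @^-1` [set nth 1%g s (index j J)].
Proof.
move=> uJ; apply/seteqP; split=> w /=.
  move=> <- j /= jJ; have jl : (index j J < l)%N by rewrite -{2}(size_tuple J) index_mem.
  by rewrite (nth_mktuple _ _ (Ordinal jl)) (tnth_nth 0%N) nth_index.
move=> Xs; apply: eq_from_tnth => i; rewrite tnth_mktuple.
by rewrite Xs /= ?mem_tnth// (tnth_nth 0%N) index_uniq ?size_tuple// -tnth_nth.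
Qed.

Lemma measurable_joint_preimage X n l (J : l.-tuple nat)
    (A : set (l.-tuple gT)) :
  measurable_process n X -> uniq J -> (forall j, j \in J -> (1 <= j <= n)%N) ->
  measurable (joint X J @^-1` A).
Proof.
move=> mX uJ Jn; apply: (@measurable_preimage_fin _ _ (l.-tuple gT)) => s.
by rewrite joint_preimage1//; exact: measurable_bigcap_seq mX Jn.
Qed.

Lemma measure_joint1 X n l (J : l.-tuple nat) (s : l.-tuple gT) :
  mutually_independent P n X -> uniq J ->
  (forall j, j \in J -> (1 <= j <= n)%N) ->
  P (joint X J @^-1` [set s]) =
  \prod_(j <- J) P (X j @^-1` [set nth 1%g s (index j J)]).
Proof.
move=> [_ iX] uJ Jn; rewrite joint_preimage1//.
exact: (iX _ uJ Jn (fun j => [set nth 1%g s (index j J)])).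
Qed.

(** Both sides expand into double sums over points [a] of [A] and [b] of [B]. For fixed [a] and [b],
    mutual independence over [J1 ++ J2] splits the product at the junction of the two lists. *)
Lemma independent_blocks X n l1 (J1 : l1.-tuple nat) l2 (J2 : l2.-tuple nat)
    (A : set (l1.-tuple gT)) (B : set (l2.-tuple gT)) :
  mutually_independent P n X -> uniq (J1 ++ J2) ->
  (forall j, j \in J1 ++ J2 -> (1 <= j <= n)%N) ->
  P (joint X J1 @^-1` A `&` joint X J2 @^-1` B) =
  P (joint X J1 @^-1` A) * P (joint X J2 @^-1` B).
Proof.
move=> iX uJ Jn; have [mX iX'] := iX.
have := uJ; rewrite cat_uniq => /and3P[uJ1 J12 uJ2].
have J1n j : j \in J1 -> (1 <= j <= n)%N by move=> jJ; rewrite Jn// mem_cat jJ.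
have J2n j : j \in J2 -> (1 <= j <= n)%N.
  by move=> jJ; rewrite Jn// mem_cat jJ orbT.
have mJ1 (C : set (l1.-tuple gT)) := measurable_joint_preimage C mX uJ1 J1n.
have mJ2 (C : set (l2.-tuple gT)) := measurable_joint_preimage C mX uJ2 J2n.
pose Z w : l1.-tuple gT * l2.-tuple gT := (joint X J1 w, joint X J2 w).
have Z1 a b : Z @^-1` [set (a, b)] =
    joint X J1 @^-1` [set a] `&` joint X J2 @^-1` [set b].
  by apply/seteqP; split=> w /= [<- <-].
have mZ x : measurable (Z @^-1` [set x]).
  by case: x => a b; rewrite Z1; exact: measurableI.
have -> : joint X J1 @^-1` A `&` joint X J2 @^-1` B = Z @^-1` (A `*` B) by [].
rewrite measure_preimage_fin//.
rewrite (@measure_preimage_fin _ _ _ P (l1.-tuple gT) _ A (fun x => mJ1 _)).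
rewrite (@measure_preimage_fin _ _ _ P (l2.-tuple gT) _ B (fun x => mJ2 _)).
rewrite ge0_sume_distrl; last by move=> *; exact: measure_ge0.
under [RHS]eq_bigr => a _ do
  rewrite (ge0_sume_distrr _ _ (fun b _ => measure_ge0 P _)).
rewrite pair_big_dep /=; apply: eq_big => [[a b]|[a b] _ /=].
  by rewrite in_setX.
rewrite Z1 (measure_joint1 _ iX)// (measure_joint1 _ iX)//.
rewrite !joint_preimage1//.
(* The two point conditions are glued into one family of sets; this is consistent because [J1] and
   [J2] are disjoint. *)
pose C j : set (discr gT) := if j \in J1 then [set nth 1%g a (index j J1)]
                             else [set nth 1%g b (index j J2)].
have C1 j : j \in J1 -> C j = [set nth 1%g a (index j J1)] by rewrite /C => ->.
have C2 j : j \in J2 -> C j = [set nth 1%g b (index j J2)].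
  move=> jJ; rewrite /C; case: ifP => // jJ1.
  by case/hasP: J12; exists j.
transitivity (P (\bigcap_(j in [set` J1 ++ J2]) X j @^-1` C j)).
  congr (P _); apply/seteqP; split=> w /=.
    move=> [w1 w2] j /=; rewrite mem_cat => /orP[] jJ.
      by rewrite C1//; exact: w1.
    by rewrite C2//; exact: w2.
  move=> wC; split=> j /= jJ.
    by have := wC j; rewrite /= mem_cat jJ C1//; exact.
  by have := wC j; rewrite /= mem_cat jJ orbT C2//; exact.
rewrite iX'// big_cat/=; congr (_ * _); apply: eq_big_seq => j jJ.
  by rewrite C1.
by rewrite C2.
Qed.

(** The product formula is assumed only for points prescribing all [n] values. Summing over the
    coordinates outside [J], each of total mass 1, gives it for every [J], and a singleton [J] gives
    the marginals. *)
Lemma mutually_independent_from_law X n (u : gT -> R) :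
  measurable_process n X -> (\sum_x u x = 1)%R ->
  (forall s : nat -> gT,
    P (\bigcap_(j in [set` iota 1 n]) X j @^-1` [set s j]) =
    (\prod_(j <- iota 1 n) u (s j))%:E) ->
  mutually_independent P n X /\
  forall j, (1 <= j <= n)%N -> forall x, P (X j @^-1` [set x]) = (u x)%:E.
Proof.
move=> mX u1 lawX.
pose v (B : set (discr gT)) := (\sum_(x : gT | x \in B) u x)%R.
have PJ (J : seq nat) (B : nat -> set (discr gT)) : uniq J ->
    (forall j, j \in J -> (1 <= j <= n)%N) ->
    P (\bigcap_(j in [set` J]) X j @^-1` B j) = (\prod_(j <- J) v (B j))%:E.
  move=> uJ Jn.
  pose Z w : {ffun 'I_n -> gT} := [ffun i : 'I_n => X i.+1 w].
  (* Ordinals start at 0 and process indices at 1, hence [i.+1]. Coordinates outside [J] are left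
     free. *)
  pose Q (i : 'I_n) : pred gT := fun x => (i.+1 \in J) ==> (x \in B i.+1).
  (* Only the values of [ext s] at indices from 1 to [n] matter; the default [1%g] is a filler. *)
  pose ext (s : {ffun 'I_n -> gT}) j := oapp s 1%g (insub j.-1).
  have extE s (i : 'I_n) : ext s i.+1 = s i by rewrite /ext /= valK.
  have Z1 s : Z @^-1` [set s] =
      \bigcap_(j in [set` iota 1 n]) X j @^-1` [set ext s j].
    apply/seteqP; split=> w /=.
      move=> <- j /=; rewrite mem_iota add1n ltnS => /andP[].
      by case: j => // j _ jn; rewrite (extE _ (Ordinal jn)) ffunE.
    move=> Xs; apply/ffunP => i; rewrite ffunE -extE.
    by apply: (Xs i.+1); rewrite /= mem_iota add1n !ltnS ltn_ord.
  have mZ s : measurable (Z @^-1` [set s]).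
    rewrite Z1; apply: (measurable_bigcap_seq (fun j => [set ext s j]) mX) => j.
    by rewrite mem_iota add1n ltnS.
  have lawZ s : P (Z @^-1` [set s]) = (\prod_(j <- iota 1 n) u (ext s j))%:E.
    by rewrite Z1; exact: (lawX (ext s)).
  have -> : \bigcap_(j in [set` J]) X j @^-1` B j =
      Z @^-1` [set s | s \in family Q].
    apply/seteqP; split=> w /=.
      move=> XB; apply/familyP => i; rewrite unfold_in; apply/implyP => iJ.
      by rewrite ffunE; apply/mem_set; exact: XB.
    move=> /familyP ZQ j /= jJ; have /andP[] := Jn _ jJ.
    case: j jJ => // j jJ _ jn; have := ZQ (Ordinal jn).
    by rewrite unfold_in /= jJ ffunE => /set_mem.
  rewrite measure_preimage_fin//.
  under [LHS]eq_bigr do rewrite lawZ.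
  rewrite sumEFin; congr EFin.
  transitivity (\sum_(s in family Q) \prod_(i < n) u (s i))%R.
    apply: eq_big => [s|s _]; first by rewrite mem_setE.
    have -> : iota 1 n = index_iota 1 n.+1 by rewrite /index_iota subn1.
    by rewrite big_add1 big_mkord; apply: eq_bigr => i _; rewrite extE.
  (* The sum over the family of a product is the product of the sums over single coordinates; those
     outside [J] contribute the factor 1 by [u1]. *)
  rewrite -(bigA_distr_big_dep _ (fun _ x => u x)).
  transitivity (\prod_(i < n | i.+1 \in J) v (B i.+1))%R.
    rewrite [RHS]big_mkcond; apply: eq_bigr => i _; rewrite /Q.
    by case: ifPn => iJ //=; rewrite u1.
  rewrite -(big_mkord (fun i => i.+1 \in J) (fun i => v (B i.+1))).
  rewrite -(big_add1 _ _ 0 n.+1 (fun j => j \in J) (fun j => v (B j))) -big_filter.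
  apply: perm_big; apply: uniq_perm => //; first by rewrite filter_uniq ?iota_uniq.
  move=> j; rewrite mem_filter mem_index_iota ltnS.
  by case: (boolP (j \in J)) => // /Jn ->.
have P1 j B : (1 <= j <= n)%N -> P (X j @^-1` B) = (v B)%:E.
  move=> jn; have := PJ [:: j] (fun=> B) isT.
  rewrite big_seq1 bigcap_seq big_seq1; apply.
  by move=> i; rewrite inE => /eqP ->.
split; last first.
  move=> j jn x; rewrite P1//; congr EFin; rewrite /v.
  rewrite (big_pred1 x)// => y.
  by apply/idP/eqP => [/set_mem|->] //; exact/mem_set.
split=> // J uJ Jn B _; rewrite PJ// -prodEFin.
by apply: eq_big_seq => j /Jn jn; rewrite P1.
Qed.

End Independence.

(** * Two-block factors of independent, identically distributed families *)

Section TwoBlockFactor.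
Context d (Omega : measurableType d) (R : realType) (P : probability Omega R).
Variables (gT hT : finGroupType) (n : nat).
Variables (X : nat -> Omega -> discr hT) (Y : nat -> Omega -> discr gT).
Variable h : gT -> gT -> discr hT.
Hypothesis Y_indep : mutually_independent P n.+1 Y.
Hypothesis XY : forall i, (1 <= i <= n)%N -> forall w, X i w = h (Y i w) (Y i.+1 w).

Lemma measurable_two_block : measurable_process n X.
Proof.
move=> i /andP[i0 iN]; rewrite (_ : X i = fun w => h (Y i w) (Y i.+1 w)).
  by case: Y_indep => mY _; apply: measurable_discr2; apply: mY; rewrite ?i0 ?ltnS// leqW.
by apply/funext => w; rewrite XY// i0.
Qed.

(* [K] lists positions relative to the start of the window [s] of Y. *)
Let blocks l (K : l.-tuple nat) (s : seq gT) : l.-tuple (discr hT) :=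
  [tuple h (nth 1%g s (tnth K i)) (nth 1%g s (tnth K i).+1) | i < l].

(** Since [K] is relative to [a], translating both the indices and the window leaves the function
    [blocks K] unchanged. The bound is on [j.+1] because [h] also reads the following position. *)
Lemma joint_two_block a m l (J K : l.-tuple nat) w :
  (forall j, j \in J -> (1 <= j <= n)%N) ->
  (forall i, tnth J i = a + tnth K i)%N ->
  (forall j, j \in K -> (j.+1 < m)%N) ->
  joint X J w = blocks K (joint Y [tuple of iota a m] w).
Proof.
move=> Jn JK Km; have nthY j : (j < m)%N ->
    nth (1%g : gT) (joint Y [tuple of iota a m] w) j = Y (a + j) w.
  move=> jm; rewrite (nth_mktuple _ _ (Ordinal jm)) (tnth_nth 0%N)/=.
  by rewrite nth_iota.
apply: eq_from_tnth => i; rewrite !tnth_mktuple XY ?Jn ?mem_tnth//.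
have Kim := Km _ (mem_tnth i K).
by rewrite !nthY ?(ltnW Kim)// JK addnS.
Qed.

(** The values of [X] before [i] read only [Y] at 1 to [i], those after [i] only [Y] at [i.+1] to
    [n.+1]. These windows are disjoint. *)
Lemma one_dependent_two_block : one_dependent P n X.
Proof.
split=> [|i /andP[i0 iN] A B _ _]; first exact: measurable_two_block.
have X1 w : joint X [tuple of iota 1 (i - 1)] w =
    blocks [tuple of iota 0 (i - 1)] (joint Y [tuple of iota 1 i] w).
  apply: joint_two_block => [j|j|j].
  - by rewrite mem_iota subnKC// => /andP[-> /ltnW/leq_trans]; exact.
  - by rewrite !(tnth_nth 0%N) /= !nth_iota.
  - by rewrite mem_iota /= add0n ltn_subRL add1n.
have X2 w : joint X [tuple of iota i.+1 (n - i)] w =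
    blocks [tuple of iota 0 (n - i)] (joint Y [tuple of iota i.+1 (n.+1 - i)] w).
  apply: joint_two_block => [j|j|j].
  - by rewrite mem_iota addSn subnKC// ltnS => /andP[/(leq_trans _)->].
  - by rewrite !(tnth_nth 0%N) /= !nth_iota.
  - by rewrite mem_iota /= add0n subSn.
rewrite (_ : joint X _ = blocks [tuple of iota 0 (i - 1)] \o
    joint Y [tuple of iota 1 i]); last exact/funext.
rewrite (_ : joint X _ = blocks [tuple of iota 0 (n - i)] \o
    joint Y [tuple of iota i.+1 (n.+1 - i)]); last exact/funext.
have iota_cat : iota 1 i ++ iota i.+1 (n.+1 - i) = iota 1 n.+1.
  by rewrite -[in RHS](subnKC (leqW iN)) iotaD add1n.
rewrite !comp_preimage; apply: (independent_blocks _ _ Y_indep).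
  by rewrite [_ ++ _]iota_cat iota_uniq.
by move=> j; rewrite [_ ++ _]iota_cat mem_iota add1n ltnS.
Qed.

Hypothesis Y_id : identically_distributed P n.+1 Y.

(** Point events have as probability a product of marginals, and these do not depend on the
    index. *)
Lemma measure_joint_identical l (J J' : l.-tuple nat) (A : set (l.-tuple gT)) :
  uniq J -> (forall j, j \in J -> (1 <= j <= n.+1)%N) ->
  uniq J' -> (forall j, j \in J' -> (1 <= j <= n.+1)%N) ->
  P (joint Y J @^-1` A) = P (joint Y J' @^-1` A).
Proof.
move=> uJ Jn uJ' J'n; have [mY _] := Y_indep.
have mJ (C : set (l.-tuple gT)) := measurable_joint_preimage C mY uJ Jn.
have mJ' (C : set (l.-tuple gT)) := measurable_joint_preimage C mY uJ' J'n.
rewrite (@measure_preimage_fin _ _ _ P (l.-tuple gT) _ A (fun x => mJ _)).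
rewrite (@measure_preimage_fin _ _ _ P (l.-tuple gT) _ A (fun x => mJ' _)).
apply: eq_bigr => s _.
rewrite (measure_joint1 _ Y_indep)// (measure_joint1 _ Y_indep)// !big_tuple.
apply: eq_bigr => i _; rewrite !(tnth_nth 0%N) !index_uniq ?size_tuple//.
by have [_ idY] := Y_id; apply: idY => //;
  [apply: Jn|apply: J'n]; rewrite mem_nth ?size_tuple.
Qed.

(** The joint values over [J] and over its shift are one function [blocks] of two windows of [Y] of
    equal length [n.+1 - m], starting at 1 and at [m.+1]. These windows have the same law. *)
Lemma stationary_two_block : stationary P n X.
Proof.
split=> [|l J m _ Jn B _]; first exact: measurable_two_block.
have J1 j : j \in J -> (1 <= j <= n)%N by move=> /Jn[].
have Jm j : j \in J -> (j + m <= n)%N by move=> /Jn[_ /andP[]].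
have Km j : j \in map_tuple predn J -> (j.+1 < n.+1 - m)%N.
  move=> /mapP[i iJ ->]; have /andP[i0 _] := J1 _ iJ.
  by rewrite prednK// ltn_subRL addnC ltnS Jm.
have JK i : tnth J i = (1 + tnth (map_tuple predn J) i)%N.
  by rewrite tnth_map add1n prednK//; have /andP[] := J1 _ (mem_tnth i J).
rewrite (_ : joint X J = blocks (map_tuple predn J) \o
    joint Y [tuple of iota 1 (n.+1 - m)]); last first.
  by apply/funext => w; exact: joint_two_block.
rewrite (_ : joint X _ = blocks (map_tuple predn J) \o
    joint Y [tuple of iota m.+1 (n.+1 - m)]); last first.
  apply/funext => w; apply: joint_two_block => // [j /mapP[i /Jn[_ ?] -> //]|i].
  by rewrite tnth_map JK /= addnAC addnC.
rewrite !comp_preimage; apply: measure_joint_identical; rewrite ?iota_uniq// => j.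
  rewrite mem_iota add1n ltnS => /andP[-> /leq_trans]; apply.
  exact: leq_subr.
rewrite mem_iota => /andP[mj jn]; rewrite (leq_trans _ mj)//=.
(* For empty [J] the shift [m] is unbounded; when it exceeds [n.+1], truncated subtraction makes the
   window empty. *)
have [mn|nm] := leqP m n.+1; first by rewrite addSn subnKC in jn.
move: jn; rewrite (eqP (ltnW nm : n.+1 - m == 0)%N) addn0 => /(leq_ltn_trans mj).
by rewrite ltnn.
Qed.

End TwoBlockFactor.

(** * Coset representatives and the multiplication step modulo [N] *)

Section Representatives.
Variables (gT : finGroupType) (G N : {group gT}) (rep : coset_of N -> gT).
Hypothesis repP : coset_representatives G rep.
Local Open Scope group_scope.

Lemma coset_rep sigma : sigma \in G / N -> coset N (rep sigma) = sigma.
Proof. by move=> /repP; exact: coset_mem. Qed.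

Lemma coset_transversal x : x \in rep @: (G / N) ->
  [/\ x \in 'N(N), coset N x \in G / N & rep (coset N x) = x].
Proof.
case/imsetP=> sigma sG ->; split; last by rewrite coset_rep.
  exact: (fintype.subsetP (coset_norm sigma)) (repP sG).
by rewrite coset_rep.
Qed.

(** Passing to cosets removes [n], and the resulting equation can be solved for the coset of [z] or
    for that of [y]. An element of the transversal is recovered from its coset by [rep]. *)
Lemma coset_remainder x y z n : x \in rep @: (G / N) -> y \in rep @: (G / N) ->
  z \in rep @: (G / N) -> n \in N -> x * y = z * n ->
  z = rep (coset N x * coset N y) /\ y = rep ((coset N x)^-1 * coset N z).
Proof.
move=> /coset_transversal[xN _ _] /coset_transversal[yN _ yE].
move=> /coset_transversal[zN _ zE] nN xyzn.
have cz : coset N z = coset N x * coset N y.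
  by rewrite -morphM//= xyzn coset_kerr.
by rewrite -cz zE; split=> //; rewrite cz mulKg yE.
Qed.

End Representatives.

Theorem lemma6p1
    (gT : finGroupType) (G N : {group gT})
    (nNG : (N <| G)%g) (NZ : (N \subset 'Z(G))%g)
    (rep : coset_of N -> gT)
    (repP : coset_representatives G rep) (rep1 : rep 1%g = 1%g)
    (T : {set gT}) (T_def : T = (rep @: (G / N))%g)
    (k : nat) (k_ge2 : (2 <= k)%N)
    (d : measure_display) (Omega : measurableType d) (R : realType)
    (P : probability Omega R)
    (t r f : nat -> Omega -> discr gT)
    (t_indep : mutually_independent P k t)
    (t_unif : forall i, (1 <= i <= k)%N -> uniform_on P T (t i))
    (rfP : forall w : Omega,
       remainders_carries T N k (fun i => t i w) (fun i => r i w)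
                                (fun i => f i w)) :
  (mutually_independent P k r /\
   forall i, (1 <= i <= k)%N -> uniform_on P T (r i)) /\
  [/\ stationary P k.-1 f,
      one_dependent P k.-1 f &
      two_block_factor P k.-1 f].
Proof.
have kE : k.-1.+1 = k by rewrite prednK// ltnW.
have le_pred i : (i <= k.-1)%N = (i < k)%N by rewrite -ltnS kE.
have tT i w : (1 <= i <= k)%N -> (t i w : gT) \in T by move=> /t_unif[].
have r1 w : r 1%N w = t 1%N w by have [] := rfP w.
have rT i w : (1 <= i <= k)%N -> (r i w : gT) \in T.
  case: i => [//|[|i]] ik; first by rewrite r1 tT.
  by have [_ /(_ i.+1)] := rfP w; rewrite le_pred => /(_ ik)[].
have step i w : (1 <= i <= k.-1)%N ->
    (r i.+1 w : gT) = rep (coset N (r i w : gT) * coset N (t i.+1 w : gT))%g /\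
    (t i.+1 w : gT) = rep ((coset N (r i w : gT))^-1 * coset N (r i.+1 w : gT))%g.
  move=> ik; have [_ /(_ i ik)[rT' fN rf]] := rfP w.
  have /andP[i0 ik'] := ik; have iltk : (i < k)%N by rewrite -le_pred.
  apply: (coset_remainder repP _ _ _ fN rf); rewrite -T_def//.
    by rewrite rT// i0 ltnW.
  exact: tT.
have [mt it] := t_indep.
(* The remainders are given only pointwise by [rfP]; measurability propagates along the recursion in
   [step]. *)
have mr : measurable_process k r.
  elim=> [//|[_ /mt|i IH ik]]; first by rewrite (_ : r 1%N = t 1%N)//; exact/funext.
  have ik' : (1 <= i.+1 <= k.-1)%N by rewrite le_pred.
  rewrite (_ : r i.+2 = fun w =>
      rep (coset N (r i.+1 w : gT) * coset N (t i.+2 w : gT))%g : discr gT).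
    apply: (measurable_discr2 (fun x y : gT => rep (coset N x * coset N y)%g : discr gT)).
      by apply: IH; exact: ltnW.
    exact: mt.
  by apply/funext => w; exact: (step _ _ ik').1.
pose u (x : gT) : R := if x \in T then (#|T|%:R^-1)%R else 0%R.
have T0 : (0 < #|T|)%N.
  apply/card_gt0P; exists (rep 1%g); rewrite T_def.
  exact: imset_f (group1 _).
have u1 : (\sum_x u x = 1)%R.
  rewrite -big_mkcond /= sumr_const -[X in X = _]mulr_natl mulfV//.
  by rewrite pnatr_eq0 -lt0n.
have law_r (s : nat -> gT) :
    P (\bigcap_(j in [set` iota 1 k]) r j @^-1` [set s j]) =
    (\prod_(j <- iota 1 k) u (s j))%:E.
  (* If some [s j] lies outside [T], the event is empty and the factor [u (s j)] is 0, so both sides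
     vanish. *)
  have [/allP sT|/allPn[j jk sj]] := boolP (all (fun j => s j \in T) (iota 1 k)); last first.
    rewrite (_ : \bigcap_(j in _) _ = set0); last first.
      apply/seteqP; split=> w //= /(_ j jk)/= rs; move: sj.
      by rewrite -rs rT//; move: jk; rewrite mem_iota add1n ltnS.
    rewrite measure0 (big_rem j)//= /u (negbTE sj) mul0r//.
  have sT' j : (1 <= j <= k)%N -> s j \in T.
    by move=> jk; apply: sT; rewrite mem_iota add1n ltnS.
  (* The unique values of t_1, ..., t_k with remainders s_1, ..., s_k. *)
  pose tau j : gT := if j is j'.+2 then
    rep ((coset N (s j'.+1))^-1 * coset N (s j))%g else s j.
  have cG x : x \in T -> coset N x \in (G / N)%g.
    by rewrite T_def => /(coset_transversal repP)[].
  have repK x : x \in T -> rep (coset N x) = x.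
    by rewrite T_def => /(coset_transversal repP)[].
  have tauG j : (1 <= j.+2 <= k)%N ->
      ((coset N (s j.+1))^-1 * coset N (s j.+2))%g \in (G / N)%g.
    by move=> jk; rewrite groupM ?groupV ?cG ?sT'//; exact: ltnW.
  have tauT j : (1 <= j <= k)%N -> tau j \in T.
    case: j => [//|[|j]] jk; first exact: sT'.
    by rewrite T_def imset_f// tauG.
  (* The two events coincide: the second half of [step] gives [t] from [r] directly, and the first
     half gives [r] from [t] by induction on the index. *)
  rewrite (_ : \bigcap_(j in _) _ =
      \bigcap_(j in [set` iota 1 k]) t j @^-1` [set tau j]); last first.
    apply/seteqP; split=> w /= sw.
      move=> j /=; rewrite mem_iota add1n ltnS.
      have rs i : (1 <= i <= k)%N -> r i w = s i.
        by move=> ik; apply: sw; rewrite /= mem_iota add1n ltnS.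
      case: j => [//|[|j]] jk; first by rewrite -r1 rs.
      rewrite (step j.+1 w _).2; last by rewrite le_pred.
      by rewrite !rs//; exact: ltnW.
    move=> j /=; rewrite mem_iota add1n ltnS.
    have ts i : (1 <= i <= k)%N -> t i w = tau i.
      by move=> ik; apply: sw; rewrite /= mem_iota add1n ltnS.
    elim: j => [//|[_ /ts|j IH jk]]; first by rewrite r1.
    rewrite (step j.+1 w _).1; last by rewrite le_pred.
    rewrite ts// IH; last exact: ltnW.
    by rewrite /tau (coset_rep repP) ?tauG// mulKVg repK ?sT'.
  rewrite it ?iota_uniq//; last by move=> j; rewrite mem_iota add1n ltnS.
  rewrite -prodEFin; apply: eq_big_seq => j; rewrite mem_iota add1n ltnS => jk.
  have [_ ->] := t_unif _ jk; last exact: tauT.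
  by rewrite /u sT'.
have [r_indep r_law] := mutually_independent_from_law mr u1 law_r.
(* This solves the carry equation for [f i], with [t i.+1] replaced by its expression in [r i] and
   [r i.+1]. *)
pose h (x y : gT) : discr gT :=
  (y^-1 * (x * rep ((coset N x)^-1 * coset N y)))%g : gT.
have fh i : (1 <= i <= k.-1)%N -> forall w, f i w = h (r i w) (r i.+1 w).
  move=> ik w; rewrite /h -(step i w ik).2.
  by have [_ /(_ i ik)[_ _ ->]] := rfP w; rewrite mulKg.
have r_id : identically_distributed P k r.
  split=> // i j ik jk B _.
  rewrite (@measure_preimage_fin _ _ _ P gT _ B) => [|x]; last first.
    by apply: measurable_preimage_discr; exact: mr.
  rewrite (@measure_preimage_fin _ _ _ P gT _ B) => [|x]; last first.
    by apply: measurable_preimage_discr; exact: mr.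
  by apply: eq_bigr => x _; rewrite !r_law.
(* The [k.-1] carries are blocks of [k] remainders, so [k] is rewritten as [k.-1.+1] to match [n.+1]
   with [n] equal to [k.-1]. *)
move: (r_indep) (r_id); rewrite -{1 2}kE => r_indep' r_id'.
split.
  split=> // i ik; split=> [w|x xT]; first exact: rT.
  by rewrite r_law// /u xT.
split.
- exact: (stationary_two_block r_indep' fh r_id').
- exact: (one_dependent_two_block r_indep' fh).
- exists default_measure_display, (discr gT), r, (fun p => h p.1 p.2).
  split=> //.
  by apply: (@measurable_discr2 _ _ gT gT gT fst snd h);
    [exact: measurable_fst | exact: measurable_snd].
Qed.
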